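(* Let $\check{\mathbf{x}}\in\mathcal{F}$ be a feasible point of the BMI problem (minimize $\mathbf{c}^\top\mathbf{x}$ over $\mathbf{x}\in\mathbb{R}^n$ subject to $p(\mathbf{x},\mathbf{x}\mathbf{x}^\top)\preceq 0$) that satisfies the MFCQ condition, and let $\mathcal{C}\in\{\mathcal{C}_1,\mathcal{C}_2,\mathcal{C}_3\}$. Then for all sufficiently large $\eta$ (i.e. there is $\eta_0>0$ such that for every $\eta\ge\eta_0$), the penalized convex relaxation $$\underset{\mathbf{x}\in\mathbb{R}^n,\ \mathbf{X}\in\mathbb{S}_n}{\text{minimize}}\ \ \mathbf{c}^\top\mathbf{x}+\eta\,(\mathrm{tr}\{\mathbf{X}\}-2\check{\mathbf{x}}^\top\mathbf{x}+\check{\mathbf{x}}^\top\check{\mathbf{x}})\quad\text{subject to}\quad p(\mathbf{x},\mathbf{X})\preceq 0,\ \ \mathbf{X}-\mathbf{x}\mathbf{x}^\top\in\mathcal{C}$$ has a unique optimal solution $(\mathbf{x}^*,\mathbf{X}^* )$, and this solution satisfies $\mathbf{X}^*=\mathbf{x}^*(\mathbf{x}^* )^\top$ and $\mathbf{c}^\top\mathbf{x}^*\le\mathbf{c}^\top\check{\mathbf{x}}$.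
   Context: Let $n,m\ge 1$ be integers and $\mathcal{N}=\{1,\dots,n\}$. $\mathbb{S}_n$ denotes the real symmetric $n\times n$ matrices; $\preceq,\prec$ denote the semidefinite (Loewner) order. Let $\mathbf{c}\in\mathbb{R}^n$ and let $p:\mathbb{R}^n\times\mathbb{S}_n\to\mathbb{S}_m$ be the matrix pencil $$p(\mathbf{x},\mathbf{X})=\mathbf{F}_0+\sum_{k\in\mathcal{N}}x_k\mathbf{K}_k+\sum_{i\in\mathcal{N}}\sum_{j\in\mathcal{N}}X_{ij}\mathbf{L}_{ij},$$ where $\mathbf{F}_0,\mathbf{K}_k,\mathbf{L}_{ij}\in\mathbb{S}_m$ and $\mathbf{L}_{ij}=\mathbf{L}_{ji}$ for all $i,j\in\mathcal{N}$. The feasible set is $\mathcal{F}=\{\mathbf{x}\in\mathbb{R}^n: p(\mathbf{x},\mathbf{x}\mathbf{x}^\top)\preceq0\}$. For $k\in\mathcal{N}$ let $\delta_k(\mathbf{x})=2\sum_{i\in\mathcal{N}}x_i\mathbf{L}_{ki}$. A point $\mathbf{x}\in\mathcal{F}$ satisfies the MFCQ condition if there exists $\mathbf{b}\in\mathbb{R}^n$ with $p(\mathbf{x},\mathbf{x}\mathbf{x}^\top)+\sum_{k\in\mathcal{N}}b_k(\mathbf{K}_k+\delta_k(\mathbf{x}))\prec0$. The sets $\mathcal{C}_k$ are: $\mathcal{C}_1=\{\mathbf{H}\in\mathbb{S}_n: \mathbf{H}\succeq0\}$; $\mathcal{C}_2=\{\mathbf{H}\in\mathbb{S}_n: H_{ii}\ge0,\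 H_{ii}H_{jj}\ge H_{ij}^2\ \ \forall i,j\in\mathcal{N}\}$; $\mathcal{C}_3=\{\mathbf{H}\in\mathbb{S}_n: H_{ii}\ge0,\ H_{ii}+H_{jj}\ge2|H_{ij}|\ \ \forall i,j\in\mathcal{N}\}$. *)

(* Defs.v *)
From mathcomp Require Import all_boot all_order all_algebra.
From mathcomp Require Import classical_sets reals.

Set Implicit Arguments.
Unset Strict Implicit.
Unset Printing Implicit Defensive.

Import Order.TTheory GRing.Theory Num.Theory.
Local Open Scope classical_set_scope.
Local Open Scope ring_scope.

Definition dotv (R : realType) (n : nat) (u v : 'cV[R]_n) : R :=
  (u^T *m v) 0 0.

(* Semidefiniteness is a property of symmetric matrices only: over the reals
   the sign of the quadratic form does not imply symmetry. *)
Definition psdmx (R : realType) (n : nat) (A : 'M[R]_n) : Prop :=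
  A \is symmetricmx /\ forall v : 'cV[R]_n, 0 <= dotv v (A *m v).

Definition pdmx (R : realType) (n : nat) (A : 'M[R]_n) : Prop :=
  A \is symmetricmx /\ forall v : 'cV[R]_n, v != 0 -> 0 < dotv v (A *m v).

Definition loewner_le (R : realType) (n : nat) (A B : 'M[R]_n) : Prop :=
  psdmx (B - A).

Definition loewner_lt (R : realType) (n : nat) (A B : 'M[R]_n) : Prop :=
  pdmx (B - A).

Section Pencil.
Variables (R : realType) (n m : nat).
Variables (F0 : 'M[R]_m) (K : 'I_n -> 'M[R]_m) (L : 'I_n -> 'I_n -> 'M[R]_m).

Definition pencil (x : 'cV[R]_n) (X : 'M[R]_n) : 'M[R]_m :=
  F0 + \sum_k x k 0 *: K k + \sum_i \sum_j X i j *: L i j.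

Definition bmi_feasible : set 'cV[R]_n :=
  [set x | loewner_le (pencil x (x *m x^T)) 0].

(* K k + pencil_delta x k is the k-th partial derivative of
   x |-> pencil x (x *m x^T) when L i j = L j i. *)
Definition pencil_delta (x : 'cV[R]_n) (k : 'I_n) : 'M[R]_m :=
  2 *: \sum_i x i 0 *: L k i.

(* Mangasarian-Fromovitz constraint qualification; feasibility of x is not
   part of this predicate. *)
Definition MFCQ (x : 'cV[R]_n) : Prop :=
  exists b : 'cV[R]_n,
    loewner_lt (pencil x (x *m x^T) + \sum_k b k 0 *: (K k + pencil_delta x k))
               0.

Definition relax_feasible (C : set 'M[R]_n) : set ('cV[R]_n * 'M[R]_n) :=
  [set z | [/\ z.2 \is symmetricmx,
               loewner_le (pencil z.1 z.2) 0 &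
               C (z.2 - z.1 *m z.1^T)]].

End Pencil.

Section Cones.
Variables (R : realType) (n : nat).

Definition cone_sdp : set 'M[R]_n := [set H | psdmx H].

Definition cone_socp : set 'M[R]_n :=
  [set H | H \is symmetricmx /\
    forall i j, 0 <= H i i /\ H i i * H j j >= H i j ^+ 2].

Definition cone_parabolic : set 'M[R]_n :=
  [set H | H \is symmetricmx /\
    forall i j, 0 <= H i i /\ H i i + H j j >= 2 * `|H i j|].

End Cones.

Definition penalized_obj (R : realType) (n : nat) (c xc : 'cV[R]_n) (eta : R)
    (z : 'cV[R]_n * 'M[R]_n) : R :=
  dotv c z.1 + eta * (\tr z.2 - 2 * dotv xc z.1 + dotv xc xc).

Definition minimizer (R : realType) (T : Type) (S : set T) (f : T -> R) (z : T)
    : Prop :=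
  S z /\ forall y, S y -> f z <= f y.

(* Main.v *)
(** Write H = X - x x^T. The penalized objective is
    c.x + eta (|x - xc|^2 + tr H), and each of the three cones contains every
    d d^T and lies in [cone_parabolic], so that tr H bounds all entries of H.
    Comparing with (xc, xc xc^T) forces x - xc = O(1/eta) and
    tr H = O(1/eta^2) on the relevant sublevel set. There, MFCQ provides a fixed
    direction b along which moving x by (tr H) b absorbs the perturbation H, i.e.
    yields a point feasible for the bilinear constraint; its objective differs
    from the old one by (tr H)(O(1) - eta), so H <> 0 is never optimal for
    large eta. Hence a minimizer over the bilinear feasible set, which exists by
    compactness, also solves the relaxation. Two distinct solutions would have a
    midpoint with H = d d^T <> 0 and the same objective, a contradiction. *)
Require Import Defs.
From mathcomp Require Import all_boot all_order all_algebra.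
From mathcomp Require Import ring lra.
From mathcomp Require Import boolp classical_sets reals topology normedtype.
From mathcomp Require Import derive.

Set Implicit Arguments.
Unset Strict Implicit.
Unset Printing Implicit Defensive.

Import Order.TTheory GRing.Theory Num.Theory.
Import numFieldNormedType.Exports.
Local Open Scope classical_set_scope.
Local Open Scope ring_scope.

(** * Bilinearity and elementary bounds for the dot product *)

Section DotProduct.
Variable R : realType.

Lemma dotvE n (u v : 'cV[R]_n) : dotv u v = \sum_i u i 0 * v i 0.
Proof. by rewrite /dotv mxE; apply: eq_bigr => i _; rewrite mxE. Qed.

Lemma dotvC n (u v : 'cV[R]_n) : dotv u v = dotv v u.
Proof. by rewrite !dotvE; apply: eq_bigr => i _; rewrite mulrC. Qed.

Lemma dotvDl n (u v w : 'cV[R]_n) : dotv (u + v) w = dotv u w + dotv v w.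
Proof. by rewrite /dotv linearD mulmxDl mxE. Qed.

Lemma dotvDr n (u v w : 'cV[R]_n) : dotv u (v + w) = dotv u v + dotv u w.
Proof. by rewrite /dotv mulmxDr mxE. Qed.

Lemma dotvZl n a (u v : 'cV[R]_n) : dotv (a *: u) v = a * dotv u v.
Proof. by rewrite /dotv linearZ -scalemxAl mxE. Qed.

Lemma dotvZr n a (u v : 'cV[R]_n) : dotv u (a *: v) = a * dotv u v.
Proof. by rewrite /dotv -scalemxAr mxE. Qed.

Lemma dotvNr n (u v : 'cV[R]_n) : dotv u (- v) = - dotv u v.
Proof. by rewrite /dotv mulmxN mxE. Qed.

Lemma dotvNl n (u v : 'cV[R]_n) : dotv (- u) v = - dotv u v.
Proof. by rewrite dotvC dotvNr dotvC. Qed.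

Lemma dotv0r n (u : 'cV[R]_n) : dotv u 0 = 0.
Proof. by rewrite /dotv mulmx0 mxE. Qed.

Lemma sqr_le_dotv n (v : 'cV[R]_n) i : v i 0 ^+ 2 <= dotv v v.
Proof.
rewrite dotvE (bigD1 i)//= expr2 lerDl.
by apply: sumr_ge0 => j _; rewrite -expr2 sqr_ge0.
Qed.

Lemma dotv_ge0 n (v : 'cV[R]_n) : 0 <= dotv v v.
Proof. by rewrite dotvE; apply: sumr_ge0 => j _; rewrite -expr2 sqr_ge0. Qed.

Lemma dotv_eq0 n (v : 'cV[R]_n) : dotv v v = 0 -> v = 0.
Proof.
move=> v0; apply/colP => i; rewrite mxE; apply/eqP; rewrite -sqrf_eq0.
by rewrite eq_le sqr_ge0 andbT -v0 sqr_le_dotv.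
Qed.

Lemma trace_outer n (x y : 'cV[R]_n) : \tr (x *m y^T) = dotv x y.
Proof.
by rewrite dotvE; apply: eq_bigr => i _; rewrite mxE big_ord1 mxE.
Qed.

Lemma dotv_outer n (v d : 'cV[R]_n) :
  dotv v ((d *m d^T) *m v) = dotv d v ^+ 2.
Proof.
rewrite -mulmxA /dotv mulmxA mxE big_ord1 expr2; congr (_ * _).
by rewrite -/(dotv v d) -/(dotv d v) dotvC.
Qed.

(** Each product [v i 0 * v j 0] is at most the mean of the two squares in absolute value, hence at
    most [dotv v v]. *)
Lemma normr_dotv_mulmx_le n (A : 'M[R]_n) (v : 'cV[R]_n) :
  `|dotv v (A *m v)| <= (\sum_i \sum_j `|A i j|) * dotv v v.
Proof.
rewrite dotvE mulr_suml (le_trans (ler_norm_sum _ _ _))//.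
apply: ler_sum => i _; rewrite mxE mulr_sumr mulr_suml.
rewrite (le_trans (ler_norm_sum _ _ _))//; apply: ler_sum => j _.
rewrite mulrCA normrM ler_wpM2l// ler_norml.
have := sqr_le_dotv v i; have := sqr_le_dotv v j.
have := sqr_ge0 (v i 0 - v j 0); have := sqr_ge0 (v i 0 + v j 0).
by rewrite !expr2 => *; apply/andP; split; lra.
Qed.

End DotProduct.

(** * Closure properties of symmetric matrices *)

Section Symmetric.
Variables (R : realType) (n : nat).
Implicit Types A B : 'M[R]_n.

Lemma symmetricmxP A : reflect (A^T = A) (A \is symmetricmx).
Proof.
apply: (iffP (is_hermitianmxP _ _ _)) => [{2}->|AE].
  by rewrite expr0 scale1r; apply/matrixP => i j; rewrite !mxE.
by rewrite expr0 scale1r -{1}AE; apply/matrixP => i j; rewrite !mxE.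
Qed.

Lemma symmetricmxD A B :
  A \is symmetricmx -> B \is symmetricmx -> A + B \is symmetricmx.
Proof.
by move=> /symmetricmxP Asym /symmetricmxP Bsym; apply/symmetricmxP;
  rewrite linearD /= Asym Bsym.
Qed.

Lemma symmetricmxZ a A : A \is symmetricmx -> a *: A \is symmetricmx.
Proof.
by move=> /symmetricmxP Asym; apply/symmetricmxP; rewrite linearZ /= Asym.
Qed.

Lemma symmetricmx_sum (I : finType) (F : I -> 'M[R]_n) :
  (forall i, F i \is symmetricmx) -> \sum_i F i \is symmetricmx.
Proof.
move=> Fsym; elim/big_ind: _ => //; last exact: symmetricmxD.
by apply/symmetricmxP; rewrite trmx0.
Qed.

Lemma symmetricmx_outer (d : 'cV[R]_n) : d *m d^T \is symmetricmx.
Proof. by apply/symmetricmxP; rewrite trmx_mul trmxK. Qed.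

End Symmetric.

(** * Comparison of the three cones and trace bounds *)

Section ConeBounds.
Variables (R : realType) (n : nat).
Implicit Types (H : 'M[R]_n) (d : 'cV[R]_n).

(** It suffices to test the quadratic form on the vectors e_i and e_i + e_j, e_i - e_j. *)
Lemma cone_sdp_parabolic H : cone_sdp H -> cone_parabolic H.
Proof.
move=> [Hsym Hpsd]; split => // i j.
have Hq a b k l : dotv (a *: delta_mx k 0 + b *: delta_mx l 0)
    (H *m (a *: delta_mx k 0 + b *: delta_mx l 0)) =
    a * a * H k k + a * b * H k l + b * a * H l k + b * b * H l l.
  have e p q : dotv (delta_mx p 0) (H *m delta_mx q 0) = H p q.
    by rewrite /dotv -colE trmx_delta -rowE !mxE.
  rewrite mulmxDr -!scalemxAr !(dotvDl, dotvDr, dotvZl, dotvZr) !e; ring.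
have Hij : H j i = H i j by rewrite -[in LHS](symmetricmxP _ Hsym) mxE.
split.
  by have := Hpsd (1 *: delta_mx i 0 + 0 *: delta_mx i 0); rewrite Hq; lra.
have := Hpsd (1 *: delta_mx i 0 + 1 *: delta_mx j 0).
have := Hpsd (1 *: delta_mx i 0 + (-1) *: delta_mx j 0).
rewrite !Hq !Hij => h1 h2.
by case: (ler0P (H i j)) => _; lra.
Qed.

(** Arithmetic-geometric mean inequality, in squared form: (H_ii + H_jj)^2 >= 4 H_ii H_jj >= 4
    H_ij^2. *)
Lemma cone_socp_parabolic H : cone_socp H -> cone_parabolic H.
Proof.
move=> [Hsym Hsocp]; split => // i j.
have [Hii Hs] := Hsocp i j; have [Hjj _] := Hsocp j i; split => //.
rewrite -ler_sqr ?nnegrE ?mulr_ge0 ?addr_ge0//.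
rewrite exprMn real_normK ?num_real//.
have := sqr_ge0 (H i i - H j j); rewrite sqrrB sqrrD; lra.
Qed.

Lemma cone_sdp_outer d : cone_sdp (d *m d^T).
Proof.
split; first exact: symmetricmx_outer.
by move=> v; rewrite dotv_outer sqr_ge0.
Qed.

Lemma cone_socp_outer d : cone_socp (d *m d^T).
Proof.
split; first exact: symmetricmx_outer.
move=> i j; rewrite !mxE !big_ord1 !mxE; split; first by rewrite -expr2 sqr_ge0.
by rewrite le_eqVlt; apply/orP; left; apply/eqP; ring.
Qed.

Lemma parabolic_trace_ge0 H : cone_parabolic H -> 0 <= \tr H.
Proof. by move=> [_ HP]; apply: sumr_ge0 => i _; case: (HP i i). Qed.

(** With a nonnegative diagonal, every diagonal entry is at most the trace, and 2 |H_ij| <= H_ii +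
    H_jj. Penalizing the trace thus controls the whole matrix. *)
Lemma parabolic_entry_le_trace H i j : cone_parabolic H -> `|H i j| <= \tr H.
Proof.
move=> [_ HP]; have diag k : H k k <= \tr H.
  rewrite /mxtrace (bigD1 k)//= lerDl.
  by apply: sumr_ge0 => l _; case: (HP l l).
have [_ Hij] := HP i j; have := diag i; have := diag j; lra.
Qed.

Lemma parabolic_trace_eq0 H : cone_parabolic H -> \tr H = 0 -> H = 0.
Proof.
move=> HP tr0; apply/matrixP => i j; rewrite mxE; apply/eqP.
by rewrite -normr_le0 -tr0 parabolic_entry_le_trace.
Qed.

End ConeBounds.

(** * Linear part, derivative and expansion of the pencil *)

Section PencilAlgebra.
Variables (R : realType) (n m : nat).
Variables (F0 : 'M[R]_m) (K : 'I_n -> 'M[R]_m) (L : 'I_n -> 'I_n -> 'M[R]_m).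
Implicit Types (x y b d : 'cV[R]_n) (X Y H : 'M[R]_n).

(** With zero constant term the pencil is jointly linear in the pair (x, X). *)
Local Notation lin := (pencil 0 K L).

Lemma pencilE x X : pencil F0 K L x X = F0 + lin x X.
Proof. by rewrite /pencil add0r addrA. Qed.

Lemma pencil_linearD x y X Y : lin (x + y) (X + Y) = lin x X + lin y Y.
Proof.
rewrite /pencil !add0r addrACA -!big_split /=; apply: eq_bigr => i _.
rewrite mxE scalerDl -!big_split /=; congr (_ + _).
by apply: eq_bigr => j _; rewrite mxE scalerDl.
Qed.

Lemma pencil_linearZ a x X : lin (a *: x) (a *: X) = a *: lin x X.
Proof.
rewrite /pencil !add0r scalerDr !scaler_sumr; congr (_ + _).
  by apply: eq_bigr => k _; rewrite mxE scalerA.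
apply: eq_bigr => i _; rewrite scaler_sumr; apply: eq_bigr => j _.
by rewrite mxE scalerA.
Qed.

Lemma symmetricmx_pencil x X : F0 \is symmetricmx ->
  (forall k, K k \is symmetricmx) -> (forall i j, L i j \is symmetricmx) ->
  pencil F0 K L x X \is symmetricmx.
Proof.
move=> F0s Ks Ls; apply: symmetricmxD; first apply: symmetricmxD => //.
  by apply: symmetricmx_sum => k; exact: symmetricmxZ.
by do 2!apply: symmetricmx_sum => ?; exact: symmetricmxZ.
Qed.

Lemma pencil_loewner_leP x X : F0 \is symmetricmx ->
  (forall k, K k \is symmetricmx) -> (forall i j, L i j \is symmetricmx) ->
  loewner_le (pencil F0 K L x X) 0 <->
  forall v, dotv v (pencil F0 K L x X *m v) <= 0.
Proof.
move=> F0s Ks Ls; rewrite /loewner_le sub0r; split=> [[_ ge0] v|le0].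
  by have := ge0 v; rewrite mulNmx dotvNr oppr_ge0.
split; last by move=> v; rewrite mulNmx dotvNr oppr_ge0.
by rewrite -scaleN1r; apply/symmetricmxZ/symmetricmx_pencil.
Qed.

(** The derivative of x x^T along b is x b^T + b x^T. By symmetry of [L] in its indices, its two
    halves contribute the same sum [S], which accounts for the factor 2 in [pencil_delta]. *)
Lemma pencil_derivE x b : (forall i j, L i j = L j i) ->
  \sum_k b k 0 *: (K k + pencil_delta L x k) = lin b (x *m b^T + b *m x^T).
Proof.
move=> LC; rewrite /pencil add0r; under eq_bigr do rewrite scalerDr.
rewrite big_split /=; congr (_ + _).
pose S := \sum_i \sum_j (b i 0 * x j 0) *: L i j.
transitivity (2 *: S).
  rewrite scaler_sumr; apply: eq_bigr => i _.
  rewrite scalerA mulrC -scalerA; congr (_ *: _).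
  by rewrite scaler_sumr; apply: eq_bigr => j _; rewrite scalerA.
have SE : S = \sum_i \sum_j (x i 0 * b j 0) *: L i j.
  rewrite /S exchange_big; apply: eq_bigr => i _; apply: eq_bigr => j _.
  by rewrite LC mulrC.
rewrite (_ : 2 = 1 + 1 :> R) // scalerDl scale1r {1}SE -big_split /=.
apply: eq_bigr => i _; rewrite -big_split /=; apply: eq_bigr => j _.
by rewrite !mxE !big_ord1 !mxE scalerDl.
Qed.

(** A valid [M] is the sum of the absolute values of all entries of all coefficient matrices; it is
    uniform in the test vector [v]. *)
Lemma pencil_linear_bound : exists2 M : R, 0 <= M &
  forall a y Y v, (forall k, `|y k 0| <= a) -> (forall i j, `|Y i j| <= a) ->
  `|dotv v (lin y Y *m v)| <= M * a * dotv v v.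
Proof.
pose N (A : 'M[R]_m) := \sum_i \sum_j `|A i j|.
have N0 A : 0 <= N A by do 2!apply: sumr_ge0 => ? _.
have termP c a A v : `|c| <= a ->
    `|dotv v ((c *: A) *m v)| <= N A * a * dotv v v.
  move=> ca; rewrite -scalemxAl dotvZr normrM mulrAC mulrC.
  by apply: ler_pM => //; exact: normr_dotv_mulmx_le.
have sumP (I : finType) (F : I -> 'M[R]_m) (G : I -> R) a v :
    (forall i, `|dotv v (F i *m v)| <= G i * a * dotv v v) ->
    `|dotv v ((\sum_i F i) *m v)| <= (\sum_i G i) * a * dotv v v.
  move=> FG; rewrite mulmx_suml !mulr_suml.
  rewrite (big_morph (dotv v) (dotvDr v) (id1 := 0)) ?dotv0r//.
  rewrite (le_trans (ler_norm_sum _ _ _))//; apply: ler_sum => i _; exact: FG.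
exists (\sum_k N (K k) + \sum_i \sum_j N (L i j)).
  by rewrite addr_ge0//; apply: sumr_ge0 => ? _ //; apply: sumr_ge0.
move=> a y Y v ya Ya; rewrite /pencil add0r mulmxDl dotvDr !mulrDl.
rewrite (le_trans (ler_normD _ _))// lerD//.
  by apply: sumP => k; exact: termP.
by do 2!apply: (sumP) => ?; exact: termP.
Qed.

(* For the quadratic map q x = pencil F0 K L x (x *m x^T) and x = xc + d this is
   q (x + s b) = (1 - s) q x + s (q x + Dq(x) b) + s^2 B(b, b), B being the
   quadratic part of q, with q x + Dq(x) b re-expanded at xc. *)
Lemma pencil_step xc d b s H :
  pencil F0 K L (xc + d + s *: b) ((xc + d + s *: b) *m (xc + d + s *: b)^T) =
  (1 - s) *: (pencil F0 K L (xc + d) ((xc + d) *m (xc + d)^T + H) - lin 0 H) +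
  s *: (pencil F0 K L xc (xc *m xc^T) + lin b (xc *m b^T + b *m xc^T) +
        lin d (xc *m d^T + d *m xc^T + d *m d^T + d *m b^T + b *m d^T)) +
  s ^+ 2 *: lin 0 (b *m b^T).
Proof.
(* The weights 1 - s and s of [F0] add up to 1. Joint linearity gathers the rest into one [lin],
   leaving one identity of vectors and one of matrices. *)
rewrite -(scaleN1r (lin 0 H)) !pencilE -!pencil_linearZ -!(addrA F0).
rewrite -!pencil_linearD.
rewrite !(scalerDr _ F0) -!pencil_linearZ [X in _ = X + _]addrACA.
rewrite -scalerDl subrK scale1r.
rewrite -[RHS]addrA -!pencil_linearD; congr (F0 + pencil _ _ _ _ _).
  by apply/matrixP => k j; rewrite !mxE; ring.
by apply/matrixP => i j; rewrite !(mxE, big_ord1); ring.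
Qed.

End PencilAlgebra.

(** * Continuity, extreme values and coercivity *)

Section Compactness.
Variable R : realType.

Lemma trmx_continuous (p q : nat) : continuous (@trmx R p q).
Proof.
move=> M s /= /(nbhs_ballP (M^T)) [e e0 es].
apply/nbhs_ballP; exists e => //= N [_ MN]; apply: es; split => // i j.
by rewrite !mxE; exact: MN.
Qed.

Lemma sum_continuous (T : topologicalType) (I : finType) (F : I -> T -> R) :
  (forall i, continuous (F i)) -> continuous (fun x => \sum_i F i x).
Proof.
move=> Fc; apply: continuous_big => [|i _]; last exact: Fc.
exact: add_continuous.
Qed.

Lemma addr_fun_continuous (T : topologicalType) (f g : T -> R) :
  continuous f -> continuous g -> continuous (fun x => f x + g x).
Proof. by move=> fc gc x; apply: (@cvgD _ R^o); [exact: fc|exact: gc]. Qed.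

Lemma mulr_fun_continuous (T : topologicalType) (f g : T -> R) :
  continuous f -> continuous g -> continuous (fun x => f x * g x).
Proof. by move=> fc gc x; apply: cvgM; [exact: fc|exact: gc]. Qed.

Lemma dotv_continuous (T : topologicalType) n (f g : T -> 'cV[R]_n) :
  (forall i, continuous (fun x => f x i 0)) ->
  (forall i, continuous (fun x => g x i 0)) ->
  continuous (fun x => dotv (f x) (g x)).
Proof.
move=> fc gc; under eq_fun do rewrite dotvE.
by apply: sum_continuous => i; exact: mulr_fun_continuous.
Qed.

Lemma mulmx_continuous (T : topologicalType) m n p
    (f : T -> 'M[R]_(m, n)) (g : T -> 'M[R]_(n, p)) :
  (forall i j, continuous (fun x => f x i j)) ->
  (forall i j, continuous (fun x => g x i j)) ->
  forall i j, continuous (fun x => (f x *m g x) i j).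
Proof.
move=> fc gc i j; under eq_fun do rewrite mxE.
by apply: sum_continuous => k; exact: mulr_fun_continuous.
Qed.

Lemma closed_le0_continuous (T : topologicalType) (f : T -> R) :
  continuous f -> closed [set x | f x <= 0].
Proof.
move=> fc; apply: (@preimage_closed _ _ f [set y | y <= 0]).
  by move=> x _; exact: fc.
exact: closed_le.
Qed.

(** A closed bounded set of columns lies in the transpose of a box of rows, a product of segments
    and hence compact. *)
Lemma cV_EVT_min n (f : 'cV[R]_n -> R) (A : set 'cV[R]_n) (B : R) :
  A !=set0 -> closed A -> (forall v, A v -> forall i, `|v i 0| <= B) ->
  continuous f -> exists2 x, A x & forall y, A y -> f x <= f y.
Proof.
move=> A0 Acl AB fc.
pose box := [set v : 'rV[R]_n | forall i, v ord0 i \in `[- B, B]].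
have box_compact : compact (trmx @` box).
  apply: continuous_compact.
    by apply: continuous_subspaceT; exact: trmx_continuous.
  apply: (@rV_compact _ _ (fun=> `[- B, B]%classic)).
  by move=> _; exact: segment_compact.
have Ac : compact A.
  apply: subclosed_compact Acl box_compact _ => v Av.
  exists (v^T); last by rewrite trmxK.
  by move=> i; rewrite in_itv /= mxE -ler_norml AB.
have [x xA xmin] := compact_EVT_min A0 Ac (continuous_subspaceT fc).
by exists x; [exact/set_mem|move=> y Ay; apply: xmin; exact/mem_set].
Qed.

(** The constant is the minimum of the quadratic form on the unit sphere, extended to all vectors by
    homogeneity. *)
Lemma pdmx_coercive n (A : 'M[R]_n) : pdmx A ->
  exists2 e : R, 0 < e & forall v, e * dotv v v <= dotv v (A *m v).
Proof.
move=> [_ Apd].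
have coordc i : continuous (fun v : 'cV[R]_n => v i 0).
  exact: coord_continuous.
have vv_continuous : continuous (fun v : 'cV[R]_n => dotv v v).
  exact: (@dotv_continuous _ _ id id).
pose S := [set v : 'cV[R]_n | dotv v v = 1].
have [e e0 eS] : exists2 e : R, 0 < e & forall v, S v -> e <= dotv v (A *m v).
  have [S0|S0] := pselect (S !=set0); last first.
    (* An empty sphere (dimension 0) makes the bound vacuous. *)
    by exists 1 => // v Sv; case: S0; exists v.
  have [||||x Sx xmin] := @cV_EVT_min n (fun v => dotv v (A *m v)) S 1.
  - exact: S0.
  - apply: (@preimage_closed _ _ (fun v : 'cV[R]_n => dotv v v) [set 1]).
      by move=> v _; exact: vv_continuous.
    exact: closed_eq.
  - move=> v Sv i; rewrite -(@ler_pXn2r _ 2)// ?nnegrE// expr1n.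
    by rewrite real_normK ?num_real// -Sv sqr_le_dotv.
  - apply: (@dotv_continuous _ _ id (mulmx A)) => // i.
    by apply: (@mulmx_continuous _ _ _ _ (fun=> A) id) => k l;
      [exact: cst_continuous|rewrite (ord1 l)].
  exists (dotv x (A *m x)) => //; apply: Apd; apply/eqP => x0.
  by move: Sx; rewrite /S /= x0 dotv0r => /esym/eqP; rewrite oner_eq0.
exists e => // v; have [->|v0] := eqVneq v 0.
  by rewrite mulmx0 !dotv0r mulr0.
have vv0 : 0 < dotv v v.
  by rewrite lt0r dotv_ge0 andbT; apply: contra_neq v0 => /dotv_eq0.
have := eS ((Num.sqrt (dotv v v))^-1 *: v); rewrite /S /= -scalemxAr.
rewrite !(dotvZl, dotvZr) !mulrA -expr2 exprVn sqr_sqrtr ?dotv_ge0//.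
by rewrite mulVf ?gt_eqF// => /(_ erefl); rewrite ler_pdivlMl// mulrC.
Qed.

End Compactness.

(** * The penalty as squared distance plus trace *)

Section PenalizedObjective.
Variables (R : realType) (n : nat) (c xc : 'cV[R]_n).

Lemma penalized_objE eta z : penalized_obj c xc eta z =
  dotv c z.1 +
  eta * (dotv (z.1 - xc) (z.1 - xc) + \tr (z.2 - z.1 *m z.1^T)).
Proof.
rewrite /penalized_obj raddfB /= trace_outer !(dotvDl, dotvDr, dotvNl, dotvNr).
rewrite (dotvC z.1 xc); congr (_ + _ * _); ring.
Qed.

Lemma penalized_obj_outer eta x : penalized_obj c xc eta (x, x *m x^T) =
  dotv c x + eta * dotv (x - xc) (x - xc).
Proof. by rewrite penalized_objE /= subrr raddf0 addr0. Qed.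

(* Completing the square in [c + eta d]. *)
Lemma penalty_bound eta t (d : 'cV[R]_n) : 0 <= eta ->
  dotv c d + eta * (dotv d d + t) <= 0 ->
  eta ^+ 2 * dotv d d + 2 * eta ^+ 2 * t <= dotv c c.
Proof.
move=> eta0 cd; have := dotv_ge0 (c + eta *: d).
rewrite !(dotvDl, dotvDr, dotvZl, dotvZr) (dotvC d c).
have := mulr_ge0_le0 eta0 cd; rewrite !expr2; lra.
Qed.

End PenalizedObjective.

Lemma normr_coord_le_sum (R : realType) n (v : 'cV[R]_n) k :
  `|v k 0| <= \sum_i `|v i 0|.
Proof. by rewrite (bigD1 k)//= lerDl sumr_ge0. Qed.

(** * Restoring bilinear feasibility and improving inexact points *)

Section Exactness.
Variables (R : realType) (n m : nat) (c : 'cV[R]_n).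
Variables (F0 : 'M[R]_m) (K : 'I_n -> 'M[R]_m) (L : 'I_n -> 'I_n -> 'M[R]_m).
Hypotheses (F0_sym : F0 \is symmetricmx)
  (K_sym : forall k, K k \is symmetricmx)
  (L_sym : forall i j, L i j \is symmetricmx)
  (LC : forall i j, L i j = L j i).
Variable xc : 'cV[R]_n.

(** By [pencil_step] along the MFCQ direction with step s = [kap * \tr H], the strictly negative
    derivative term is of order s, hence of order tr H. It outweighs both the removal of [H] and the
    second-order term in s. *)
Lemma bmi_restoration : MFCQ F0 K L xc ->
  exists b : 'cV[R]_n, exists2 delta : R, 0 < delta <= 1 &
  forall (d : 'cV[R]_n) (H : 'M[R]_n),
    (forall k, `|d k 0| <= delta) -> \tr H <= delta ->
    cone_parabolic H ->
    loewner_le (pencil F0 K L (xc + d) ((xc + d) *m (xc + d)^T + H)) 0 ->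
    bmi_feasible F0 K L (xc + d + \tr H *: b).
Proof.
move=> [b]; rewrite /loewner_lt sub0r pencil_derivE// =>
  /pdmx_coercive[e e0 eP].
have [M M0 MP] := pencil_linear_bound K L.
pose be := \sum_i `|b i 0|; pose xi := \sum_i `|xc i 0|.
have be0 : 0 <= be by apply: sumr_ge0.
have xi0 : 0 <= xi by apply: sumr_ge0.
(* Chosen so that a decrease of rate e/2 over the step [kap * t] gives 2 (M + 1) t. *)
pose kap := 4 * (M + 1) / e.
have kap0 : 0 <= kap by rewrite /kap divr_ge0 ?mulr_ge0 ?addr_ge0// ltW.
pose A1 := 2 * M * (2 + 2 * xi + 2 * be) / e.
pose A2 := kap ^+ 2 * M * be ^+ 2.
have A10 : 0 <= A1 by rewrite /A1 divr_ge0 ?mulr_ge0 ?(ltW e0)//; lra.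
have A20 : 0 <= A2.
  by apply: mulr_ge0 (sqr_ge0 _); apply: mulr_ge0 (sqr_ge0 _) M0.
(* One radius for four needs: [delta <= 1]; [A1 * delta <= 1] keeps the drift [B] below e/2;
   [kap * delta <= 1] keeps s in [0, 1]; [A2 * delta <= 1] tames the s^2 term. *)
pose delta := (1 + A1 + kap + A2)^-1.
have D0 : 0 < 1 + A1 + kap + A2 by lra.
have delta0 : 0 < delta by rewrite invr_gt0.
have deltaE : delta + A1 * delta + kap * delta + A2 * delta = 1.
  by rewrite -[X in X + _ + _ + _]mul1r -!mulrDl mulfV ?gt_eqF.
have A1d : 0 <= A1 * delta by rewrite mulr_ge0// ltW.
have A2d : 0 <= A2 * delta by rewrite mulr_ge0// ltW.
have kapd : 0 <= kap * delta by rewrite mulr_ge0// ltW.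
have delta1 : delta <= 1 by lra.
exists (kap *: b), delta; first exact/andP.
move=> d H ddelta; set t := \tr H => tdelta HP feas.
have t0 : 0 <= t by exact: parabolic_trace_ge0.
rewrite scalerA (mulrC t); set s := kap * t.
have s0 : 0 <= s by exact: mulr_ge0.
have s1 : s <= 1.
  by apply: (@le_trans _ _ (kap * delta)); [exact: ler_wpM2l|lra].
apply/pencil_loewner_leP => // v.
have {feas} := (pencil_loewner_leP _ _ F0_sym K_sym L_sym).1 feas v.
have qE (P N A B E : 'M[R]_m) :
    dotv v (((1 - s) *: (P - N) + s *: (A + B) + s ^+ 2 *: E) *m v) =
    (1 - s) * (dotv v (P *m v) - dotv v (N *m v)) +
    s * (dotv v (A *m v) + dotv v (B *m v)) + s ^+ 2 * dotv v (E *m v).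
  by rewrite !(mulmxDl, dotvDr) -!scalemxAl !dotvZr !mulmxBl !mulmxDl
    !dotvDr dotvNr.
rewrite (pencil_step _ _ _ _ _ _ _ H) qE.
set P := pencil F0 K L _ _; set A := _ + pencil 0 K L b _.
set B := pencil 0 K L d _; set E := pencil 0 K L 0 (b *m b^T) => Pv.
have Hv : `|dotv v (pencil 0 K L 0 H *m v)| <= M * t * dotv v v.
  apply: MP => [k|i j]; first by rewrite mxE normr0.
  exact: parabolic_entry_le_trace.
have Av : dotv v (A *m v) <= - (e * dotv v v).
  by have := eP v; rewrite mulNmx dotvNr lerNr.
have Bv : `|dotv v (B *m v)| <=
    M * (delta * (2 + 2 * xi + 2 * be)) * dotv v v.
  have xbd : 0 <= delta * xi by rewrite mulr_ge0// ltW.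
  have bbd : 0 <= delta * be by rewrite mulr_ge0// ltW.
  apply: MP => [k|i j]; first by have := ddelta k; lra.
  (* Five products to bound, each with a factor from [d]; in d d^T the second factor is bounded by
     1. *)
  rewrite !(mxE, big_ord1).
  have bnd (p q r : R) : `|p| <= delta -> `|q| <= r -> `|p * q| <= delta * r.
    by move=> *; rewrite normrM; apply: ler_pM.
  have h1 := bnd _ _ _ (ddelta j) (normr_coord_le_sum xc i).
  have h2 := bnd _ _ _ (ddelta i) (normr_coord_le_sum xc j).
  have h3 := bnd _ _ 1 (ddelta i) (le_trans (ddelta j) delta1).
  have h4 := bnd _ _ _ (ddelta i) (normr_coord_le_sum b j).
  have h5 := bnd _ _ _ (ddelta j) (normr_coord_le_sum b i).
  rewrite (mulrC (xc i 0)) (mulrC (b i 0)).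
  do 4![rewrite (le_trans (ler_normD _ _))// -lerBrDr].
  by rewrite -/xi -/be in h1 h2 h4 h5 *; lra.
have Ev : `|dotv v (E *m v)| <= M * be ^+ 2 * dotv v v.
  apply: MP => [k|i j]; first by rewrite mxE normr0 sqr_ge0.
  rewrite !(mxE, big_ord1) normrM expr2.
  by apply: ler_pM => //; exact: normr_coord_le_sum.
have w0 := dotv_ge0 v; set w := dotv v v in Hv Av Bv Ev w0 *.
have tw0 : 0 <= t * w by exact: mulr_ge0.
move: Hv Bv Ev; rewrite !ler_norml => /andP[Hv _] /andP[_ Bv] /andP[_ Ev].
have {}Bv : dotv v (B *m v) <= e / 2 * w.
  apply: (le_trans Bv); rewrite ler_wpM2r// mulrCA.
  have -> : delta * (M * (2 + 2 * xi + 2 * be)) = A1 * delta * (e / 2).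
    by rewrite /A1; field; rewrite gt_eqF.
  by rewrite ler_piMl; lra.
(* The gain, 2 (M + 1) t w, exceeds the losses M t w ([sPH]) and t w ([sE]). *)
have sAB : s * (dotv v (A *m v) + dotv v (B *m v)) <= - (2 * (M + 1) * (t * w)).
  have -> : - (2 * (M + 1) * (t * w)) = s * - (e / 2 * w).
    by rewrite /s /kap; field; rewrite gt_eqF.
  by rewrite ler_wpM2l//; lra.
have sPH : (1 - s) * (dotv v (P *m v) - dotv v (pencil 0 K L 0 H *m v)) <=
    M * (t * w).
  apply: (@le_trans _ _ ((1 - s) * (M * (t * w)))).
    by rewrite ler_wpM2l ?subr_ge0// mulrA; lra.
  by rewrite ler_piMl ?mulr_ge0//; lra.
have sE : s ^+ 2 * dotv v (E *m v) <= t * w.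
  apply: (@le_trans _ _ (s ^+ 2 * (M * be ^+ 2 * w))).
    by rewrite ler_wpM2l ?sqr_ge0.
  have -> : s ^+ 2 * (M * be ^+ 2 * w) = A2 * t * (t * w).
    by rewrite /s /A2; ring.
  rewrite ler_piMl//; apply: (@le_trans _ _ (A2 * delta)); last by lra.
  exact: ler_wpM2l.
have Mtw : 0 <= M * (t * w) by exact: mulr_ge0.
lra.
Qed.

(** The restored point trades the trace penalty eta t for changes of size O(t), with t = tr H > 0;
    the exchange is profitable once eta is large. *)
Lemma relaxed_improvement : MFCQ F0 K L xc ->
  exists2 eta0 : R, 0 < eta0 & forall eta z, eta0 <= eta ->
    loewner_le (pencil F0 K L z.1 z.2) 0 ->
    cone_parabolic (z.2 - z.1 *m z.1^T) -> z.2 != z.1 *m z.1^T ->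
    penalized_obj c xc eta z <= dotv c xc ->
    exists2 x, bmi_feasible F0 K L x &
      penalized_obj c xc eta (x, x *m x^T) < penalized_obj c xc eta z.
Proof.
move=> /bmi_restoration[b [delta /andP[delta0 delta1] descent]].
pose Nb := dotv b b; pose Nc := dotv c c.
have Nb0 : 0 <= Nb by exact: dotv_ge0.
have Nc0 : 0 <= Nc by exact: dotv_ge0.
have NbNc0 : 0 <= Nc * Nb by exact: mulr_ge0.
have cb := ler_norm (dotv c b).
have Ncd0 : 0 <= (Nc + 1) / delta by rewrite divr_ge0 ?addr_ge0// ltW.
(* The last summand brings [d] and [t] within [delta]; the others make eta at least 1 and larger
   than the coefficient of t gained by moving. *)
exists (1 + `|dotv c b| + Nb + Nc + Nc * Nb + (Nc + 1) / delta).
  by have := normr_ge0 (dotv c b); lra.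
move=> eta [x X] /= eta0 feas HP XE obj_le.
have cb0 := normr_ge0 (dotv c b).
have eta1 : 1 <= eta by lra.
have etapos : 0 < eta by lra.
pose d := x - xc; pose H := X - x *m x^T; pose t := \tr H.
have xE : xc + d = x by rewrite addrC subrK.
have t_ge0 : 0 <= t by exact: parabolic_trace_ge0.
have t_gt0 : 0 < t.
  rewrite lt0r t_ge0 andbT; apply: contra_neq XE => tr0.
  by apply/eqP; rewrite -subr_eq0; apply/eqP/parabolic_trace_eq0.
have bound : eta ^+ 2 * dotv d d + 2 * eta ^+ 2 * t <= Nc.
  apply: penalty_bound; first exact: ltW.
  by move: obj_le; rewrite penalized_objE /= -/d -/H -/t -{1}xE dotvDr; lra.
have Nd0 := dotv_ge0 d.
have eta2d0 : 0 <= eta ^+ 2 * dotv d d by rewrite mulr_ge0 ?sqr_ge0.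
have eta2t0 : 0 <= eta ^+ 2 * t by rewrite mulr_ge0 ?sqr_ge0.
have etadelta : Nc + 1 <= eta * delta.
  by rewrite -ler_pdivrMr//; lra.
(* Combined with [bound], this gives |d|^2 <= delta^2 and t <= delta^2. *)
have Nc_le : Nc <= eta ^+ 2 * delta ^+ 2.
  rewrite -exprMn; apply: (@le_trans _ _ ((Nc + 1) ^+ 2)).
    by have := sqr_ge0 Nc; rewrite sqrrD; lra.
  by rewrite ler_sqr ?nnegrE; lra.
have d_le k : `|d k 0| <= delta.
  rewrite -ler_sqr ?nnegrE ?(ltW delta0)// real_normK ?num_real//.
  apply: (le_trans (sqr_le_dotv d k)).
  by rewrite -(ler_pM2l (exprn_gt0 2 etapos)); lra.
have t_le : t <= delta.
  apply: (@le_trans _ _ (delta ^+ 2)).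
    by rewrite -(ler_pM2l (exprn_gt0 2 etapos)); lra.
  by rewrite expr2 ler_piMl// ltW.
exists (x + t *: b).
  rewrite -xE; apply: (descent d H) => //.
  by rewrite xE /H addrC subrK.
rewrite penalized_obj_outer penalized_objE /= -/d -/H -/t (addrAC x) -/d.
clearbody d; rewrite !(dotvDl, dotvDr, dotvZl, dotvZr) (dotvC d b) -/Nb.
(* Expand |b - eta d|^2 >= 0 and use eta^2 |d|^2 <= [Nc]. *)
have bd : 2 * (eta * dotv b d) <= Nb + Nc.
  have := dotv_ge0 (b + - eta *: d).
  rewrite !(dotvDl, dotvDr, dotvZl, dotvZr) (dotvC d b) -/Nb.
  rewrite expr2 in bound eta2d0 eta2t0; lra.
have tNb : eta * t * Nb <= Nc * Nb.
  rewrite ler_wpM2r//; apply: (@le_trans _ _ (eta ^+ 2 * t)); last lra.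
  by rewrite ler_wpM2r// expr2 ler_peMl// ltW.
(* The left-hand side is exactly the change of the penalized objective. *)
have : t * (dotv c b + 2 * (eta * dotv b d) + eta * t * Nb - eta) < 0.
  rewrite pmulr_rlt0//; lra.
lra.
Qed.

End Exactness.

(** * Existence of a penalized minimum over the bilinear set *)

Section Existence.
Variables (R : realType) (n m : nat) (c xc : 'cV[R]_n).
Variables (F0 : 'M[R]_m) (K : 'I_n -> 'M[R]_m) (L : 'I_n -> 'I_n -> 'M[R]_m).
Hypotheses (F0_sym : F0 \is symmetricmx)
  (K_sym : forall k, K k \is symmetricmx)
  (L_sym : forall i j, L i j \is symmetricmx).

(** It is an intersection, over all test vectors, of sublevel sets of polynomials in x. *)
Lemma bmi_feasible_closed : closed (bmi_feasible F0 K L).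
Proof.
pose q v (x : 'cV[R]_n) := dotv v (pencil F0 K L x (x *m x^T) *m v).
have -> : bmi_feasible F0 K L = \bigcap_v [set x | q v x <= 0].
  apply/seteqP; split => x.
    by move=> /(pencil_loewner_leP _ _ F0_sym K_sym L_sym) qx v _; exact: qx.
  by move=> qx; apply/pencil_loewner_leP => // v; exact: qx.
have coordc k : continuous (fun x : 'cV[R]_n => x k 0).
  exact: coord_continuous.
apply: closed_bigI => v _; apply: closed_le0_continuous.
apply: (@dotv_continuous _ _ _ (fun=> v)) => i; first exact: cst_continuous.
apply: (@mulmx_continuous _ _ _ _ _ _ (fun=> v)) => k l;
  last exact: cst_continuous.
under eq_fun do rewrite /pencil !mxE !summxE.
apply: addr_fun_continuous.
  apply: addr_fun_continuous; first exact: cst_continuous.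
  apply: sum_continuous => p; under eq_fun do rewrite mxE.
  by apply: mulr_fun_continuous => //; exact: cst_continuous.
apply: sum_continuous => p; under eq_fun do rewrite summxE.
apply: sum_continuous => r; under eq_fun do rewrite !mxE big_ord1 !mxE.
apply: mulr_fun_continuous; last exact: cst_continuous.
exact: mulr_fun_continuous.
Qed.

Lemma bmi_penalized_minimum eta : 0 < eta -> bmi_feasible F0 K L xc ->
  exists2 x, bmi_feasible F0 K L x & forall y, bmi_feasible F0 K L y ->
    penalized_obj c xc eta (x, x *m x^T) <=
    penalized_obj c xc eta (y, y *m y^T).
Proof.
move=> eta0 xc_feas.
pose phi (x : 'cV[R]_n) := dotv c x + eta * dotv (x - xc) (x - xc).
have coordc k : continuous (fun x : 'cV[R]_n => x k 0).
  exact: coord_continuous.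
have shiftc k : continuous (fun x : 'cV[R]_n => (x - xc) k 0).
  under eq_fun do rewrite mxE.
  by apply: addr_fun_continuous => //; exact: cst_continuous.
have phic : continuous phi.
  apply: addr_fun_continuous.
    by apply: (@dotv_continuous _ _ _ (fun=> c) id) => // k;
      exact: cst_continuous.
  by apply: mulr_fun_continuous; [exact: cst_continuous|exact: dotv_continuous].
pose A := bmi_feasible F0 K L `&` [set x | phi x + - phi xc <= 0].
(* On the sublevel set of [xc], [penalty_bound] with zero trace term bounds each squared deviation,
   and |a| <= 1 + a^2 removes the square. *)
pose B := \sum_i `|xc i 0| + (1 + dotv c c / eta ^+ 2).
have [||||x [xfeas xle] xmin] := @cV_EVT_min _ n phi A B.
- by exists xc; split => //=; rewrite subrr.
- apply: closedI; first exact: bmi_feasible_closed.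
  apply: closed_le0_continuous.
  by apply: addr_fun_continuous => //; exact: cst_continuous.
- move=> x [_ /= xle] i.
  have ble : eta ^+ 2 * dotv (x - xc) (x - xc) <= dotv c c.
    have := @penalty_bound _ _ c eta 0 (x - xc) (ltW eta0).
    rewrite mulr0 !addr0; apply; move: xle.
    rewrite /phi subrr dotv0r mulr0 addr0.
    by rewrite (dotvDr c) dotvNr; lra.
  have xi : (x - xc) i 0 ^+ 2 <= dotv c c / eta ^+ 2.
    rewrite ler_pdivlMr ?exprn_gt0// mulrC (le_trans _ ble)//.
    by rewrite ler_wpM2l ?sqr_ge0// sqr_le_dotv.
  rewrite -[x](subrK xc) mxE addrC (le_trans (ler_normD _ _))// lerD//.
    exact: normr_coord_le_sum.
  apply: (@le_trans _ _ (1 + (x - xc) i 0 ^+ 2)); last by rewrite lerD2l.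
  rewrite -real_normK ?num_real//; set a := `|_|.
  by have := sqr_ge0 (a - 1); have := sqr_ge0 a; rewrite sqrrB expr1n; lra.
- exact: phic.
exists x => // y yfeas; rewrite !penalized_obj_outer -/(phi x) -/(phi y).
have [yle|/ltW xcy] := leP (phi y) (phi xc).
  by apply: xmin; split => //=; rewrite subr_le0.
by rewrite /= subr_le0 in xle; exact: le_trans xle xcy.
Qed.

End Existence.

(** * Optimality of the lifted minimizer, then uniqueness *)

Theorem theorem1 (R : realType) (n m : nat) (hn : (1 <= n)%N) (hm : (1 <= m)%N)
    (c : 'cV[R]_n) (F0 : 'M[R]_m) (K : 'I_n -> 'M[R]_m)
    (L : 'I_n -> 'I_n -> 'M[R]_m)
    (F0_sym : F0 \is symmetricmx)
    (K_sym : forall k, K k \is symmetricmx)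
    (L_sym : forall i j, L i j \is symmetricmx)
    (LC : forall i j, L i j = L j i)
    (xc : 'cV[R]_n)
    (xc_feasible : bmi_feasible F0 K L xc)
    (xc_MFCQ : MFCQ F0 K L xc)
    (C : set 'M[R]_n)
    (hC : C = @cone_sdp R n \/ C = @cone_socp R n \/ C = @cone_parabolic R n) :
  exists2 eta0 : R, 0 < eta0 & forall eta : R, eta0 <= eta ->
    exists z : 'cV[R]_n * 'M[R]_n,
      [/\ unique (minimizer (relax_feasible F0 K L C) (penalized_obj c xc eta)) z,
          z.2 = z.1 *m z.1^T &
          dotv c z.1 <= dotv c xc].
Proof.
have C_parabolic H : C H -> cone_parabolic H.
  by case: hC => [|[]] ->;
    [exact: cone_sdp_parabolic|exact: cone_socp_parabolic|].
have C_outer (d : 'cV[R]_n) : C (d *m d^T).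
  case: hC => [|[]] ->; [exact: cone_sdp_outer|exact: cone_socp_outer|].
  exact/cone_socp_parabolic/cone_socp_outer.
have C0 : C 0 by have := C_outer 0; rewrite mul0mx.
have [eta0 eta0_gt0 improve] :=
  relaxed_improvement c F0_sym K_sym L_sym LC xc_MFCQ.
exists eta0 => // eta etaP; have eta_gt0 := lt_le_trans eta0_gt0 etaP.
have [x xfeas xmin] :=
  bmi_penalized_minimum c F0_sym K_sym L_sym eta_gt0 xc_feasible.
have obj_xc : penalized_obj c xc eta (xc, xc *m xc^T) = dotv c xc.
  by rewrite penalized_obj_outer subrr dotv0r mulr0 addr0.
have lifted y : bmi_feasible F0 K L y ->
    relax_feasible F0 K L C (y, y *m y^T).
  by move=> yfeas; split => //=; [exact: symmetricmx_outer|rewrite subrr].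
(* An inexact point either lies below the value at [xc], where it can be improved, or is already
   above that value. *)
have strict y : relax_feasible F0 K L C y -> y.2 != y.1 *m y.1^T ->
    penalized_obj c xc eta (x, x *m x^T) < penalized_obj c xc eta y.
  move=> [_ yfeas yC] yne.
  have [yle|] := leP (penalized_obj c xc eta y) (dotv c xc).
    have [u ufeas] := improve _ _ etaP yfeas (C_parabolic _ yC) yne yle.
    by apply: le_lt_trans; exact: xmin.
  by apply: le_lt_trans; rewrite -obj_xc; exact: xmin.
have zmin : minimizer (relax_feasible F0 K L C) (penalized_obj c xc eta)
    (x, x *m x^T).
  split; first exact: lifted.
  move=> [y Y] yfeas; have [/= YE|yne] := eqVneq Y (y *m y^T).
    by rewrite YE; apply: xmin; case: yfeas => _ /=; rewrite YE.
  exact/ltW/strict.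
exists (x, x *m x^T); split => //=; last first.
  have := xmin _ xc_feasible; rewrite obj_xc penalized_obj_outer.
  have := mulr_ge0 (ltW eta_gt0) (dotv_ge0 (x - xc)); lra.
split => // y ymin.
have exact_min u : minimizer (relax_feasible F0 K L C)
    (penalized_obj c xc eta) u -> u.2 = u.1 *m u.1^T.
  move=> [ufeas umin]; apply: contrapT => /eqP /(strict _ ufeas).
  by rewrite ltNge umin//; exact: lifted.
have yE := exact_min _ ymin; case: y => [y Y] /= in ymin yE *; subst Y.
(* The average of the two lifted solutions has gap d d^T, which lies in [C]; it is again optimal,
   hence exact, so d = 0. *)
pose u := 2^-1 *: (x + y); pose d := 2^-1 *: (x - y).
pose U := 2^-1 *: (x *m x^T + y *m y^T).
have UE : U - u *m u^T = d *m d^T.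
  by apply/matrixP => i j; rewrite !(mxE, big_ord1); field.
have [[_ xf _] _] := zmin; have [[_ yf _] y_le] := ymin.
have objU : penalized_obj c xc eta (u, U) =
    penalized_obj c xc eta (x, x *m x^T).
  have xy : penalized_obj c xc eta (x, x *m x^T) =
      penalized_obj c xc eta (y, y *m y^T).
    by apply/eqP; rewrite eq_le zmin.2 ?ymin.2//; [exact: zmin.1|exact: ymin.1].
  transitivity (2^-1 * (penalized_obj c xc eta (x, x *m x^T) +
      penalized_obj c xc eta (y, y *m y^T))); last by rewrite -xy; field.
  by rewrite /penalized_obj /= /u /U mxtraceZ mxtraceD !dotvZr !dotvDr; field.
have Umin : minimizer (relax_feasible F0 K L C) (penalized_obj c xc eta) (u, U).
  split; last by move=> w wfeas; rewrite objU; exact: zmin.2.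
  split => /=; last by rewrite UE.
    by apply/symmetricmxZ/symmetricmxD; exact: symmetricmx_outer.
  apply/pencil_loewner_leP => // v.
  have := (pencil_loewner_leP _ _ F0_sym K_sym L_sym).1 xf v.
  have := (pencil_loewner_leP _ _ F0_sym K_sym L_sym).1 yf v => /=.
  have -> : pencil F0 K L u U =
      2^-1 *: (pencil F0 K L x (x *m x^T) + pencil F0 K L y (y *m y^T)).
    have F0E : F0 = 2^-1 *: (F0 + F0).
      by rewrite scalerDr -scalerDl (_ : 2^-1 + 2^-1 = 1) ?scale1r//; field.
    by rewrite !(pencilE F0) addrACA -pencil_linearD scalerDr -F0E
      -pencil_linearZ.
  rewrite -scalemxAl dotvZr => ya xa.
  by rewrite pmulr_rle0 ?invr_gt0// mulmxDl dotvDr; lra.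
have dd0 : d *m d^T = 0 by rewrite -UE [U](exact_min _ Umin) subrr.
have d0 : d = 0 by apply: dotv_eq0; rewrite -trace_outer dd0 mxtrace0.
have xy : x = y.
  apply/eqP; rewrite -subr_eq0; apply/eqP/colP => i.
  by have /colP/(_ i) := d0; rewrite !mxE; lra.
by rewrite xy.
Qed.
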